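(* Let $f:\mathbb{R}^+\to\mathbb{R}^+$ be a function for which the Hirsch function $h_f$ is defined, and suppose that $h_f$ is continuous on $\mathbb{R}_0^+$. Then $h_f$ is of one of the following three types: (i) $h_f$ is injective on $\mathbb{R}_0^+$; (ii) there is $y_0>0$ such that $h_f=\mathbf{0}$ on the interval $]0,y_0]$ and $h_f$ is strictly increasing on the complement $]y_0,+\infty[$; (iii) there is $x_0>0$ such that $h_f=\mathbf{0}$ on the interval $[x_0,+\infty[$ and $h_f$ is strictly decreasing on the complement $]0,x_0[$; or $h_f=\mathbf{0}$ on all of $\mathbb{R}_0^+$ (this case being included in type (iii)).
   Context: $\mathbb{R}^+=[0,+\infty[$ and $\mathbb{R}_0^+=\mathbb{R}^+\setminus\{0\}$; $\mathbf{0}$ denotes the null function (identically zero). For a function $f:\mathbb{R}^+\to\mathbb{R}^+$, the Hirsch function $h_f:\mathbb{R}_0^+\to\mathbb{R}^+$ is defined, for $\theta\in\mathbb{R}_0^+$, by: $x=h_f(\theta)\Leftrightarrow f(x)=\theta x$. Only functions $f$ are considered for which this equation has a unique solution $x$ for every $\theta\in\mathbb{R}_0^+$, with the following convention: if $f(0)=0$ (so that $x=0$ always solves the equation), the solution $x=0$ is disregarded whenever a solution $x>0$ exists, and $h_f(\theta)=0$ if $x=0$ is the only solution. *)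

(* Defs.v *)
From HB Require Import structures.
From mathcomp Require Import all_boot all_order all_algebra.
From mathcomp Require Import all_classical all_reals all_analysis.

Set Implicit Arguments.
Unset Strict Implicit.
Unset Printing Implicit Defensive.

Import Order.TTheory GRing.Theory Num.Theory.
Import numFieldNormedType.Exports.

Local Open Scope classical_set_scope.
Local Open Scope ring_scope.

(* A function on R^+ = [0, +oo[ is represented by a total function on R;
   its values at negative arguments are never used. *)
Definition maps_nonneg_to_nonneg (R : realType) (f : R -> R) : Prop :=
  forall x : R, 0 <= x -> 0 <= f x.

(* The solutions in R^+ of f x = theta * x, where the trivial solution x = 0
   (present exactly when f 0 = 0) is disregarded as soon as a solution x > 0
   exists. *)
Definition hirsch_solutions (R : realType) (f : R -> R) (theta : R) : set R :=
  [set x | [/\ 0 <= x, f x = theta * x &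
      x = 0 -> ~ exists2 y : R, 0 < y & f y = theta * y]].

Definition hirsch_defined (R : realType) (f : R -> R) : Prop :=
  forall theta : R, 0 < theta -> exists! x : R, hirsch_solutions f theta x.

(* Only meaningful for theta > 0 and hirsch_defined f, in which case it is the
   unique element of hirsch_solutions f theta. *)
Definition hirsch (R : realType) (f : R -> R) (theta : R) : R :=
  xget 0 (hirsch_solutions f theta).

(* Main.v *)
(** A positive value x = h_f(theta) determines theta = f(x) / x, so h_f takes
    each positive value at most once. By the intermediate value theorem a strict
    interior maximum or minimum would force some positive value to be taken on
    both sides of it. Hence, if h_f has a zero left of a positive value, it
    vanishes up to the last zero and is strictly increasing afterwards; the
    mirror case follows by the reflection theta -> - theta. *)
Require Import Defs.
From HB Require Import structures.
From mathcomp Require Import all_boot all_order all_algebra.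
From mathcomp Require Import all_classical all_reals all_analysis.
From mathcomp Require Import lra.

Set Implicit Arguments.
Unset Strict Implicit.
Unset Printing Implicit Defensive.

Import Order.TTheory GRing.Theory Num.Theory.
Import numFieldNormedType.Exports.

Local Open Scope classical_set_scope.
Local Open Scope ring_scope.

Section Unimodal.
(** [D] stays abstract to cover both the positive half-line and its mirror image. Continuity enters
    only through the intermediate value property, which reflection preserves by swapping
    endpoints. *)
Variables (R : realType) (D : set R) (h : R -> R).
Hypothesis D_itv : is_interval D.
Hypothesis h_ge0 : forall x, D x -> 0 <= h x.
Hypothesis h_inj : forall x y, D x -> D y -> 0 < h x -> h x = h y -> x = y.
Hypothesis h_ivt : forall a b l, D a -> D b -> a <= b ->
  Num.min (h a) (h b) <= l <= Num.max (h a) (h b) ->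
  exists2 c, a <= c <= b & h c = l.

(** The level [l] is attained at some [u] in [a, b] and some [v] in [b, c]. Being positive, it is
    attained only once, so [u = v = b], although [h b] differs from [l]. *)
Lemma no_strict_extremum a b c l : D a -> D c -> a <= b <= c -> 0 < l ->
  (h a <= l < h b /\ h c <= l) \/ (h b < l <= h a /\ l <= h c) -> False.
Proof.
move=> Da Dc abc l0 H; have [ab bc] := andP abc.
have Db : D b by apply: D_itv Da Dc _ _.
have [|u /andP[au ub] hu] := h_ivt (l := l) Da Db ab.
  by rewrite ge_min le_max; case: H => -[/andP[h1 h2] _]; rewrite ?h1 ?h2 ?(ltW h1) ?(ltW h2) ?orbT.
have [|v /andP[bv vc] hv] := h_ivt (l := l) Db Dc bc.
  by rewrite ge_min le_max; case: H => -[/andP[h1 h2] h3]; rewrite ?h3 ?(ltW h1) ?(ltW h2) ?orbT.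
have Du : D u by apply: D_itv Da Db _ _; rewrite au.
have Dv : D v by apply: D_itv Db Dc _ _; rewrite bv.
have uv : u = v by apply: h_inj => //; rewrite hu.
have ubE : u = b by apply/le_anti; rewrite ub uv bv.
by move: H; rewrite -ubE hu ltxx /= andbF => -[[]|[]].
Qed.

(** The witness [y0] is the supremum of the zero set. *)
Lemma zero_then_increasing z p : D z -> D p -> z < p -> h z = 0 -> 0 < h p ->
  exists y0, [/\ D y0, forall x, D x -> x <= y0 -> h x = 0 &
    forall s t, D s -> D t -> y0 < s -> s < t -> h s < h t].
Proof.
move=> Dz Dp zp hz hp.
have hp2 : 0 < h p / 2 by rewrite divr_gt0.
(* A zero at or beyond [p] would make [p] a strict maximum between two zeros. *)
have zero_lt w : D w -> h w = 0 -> w < p.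
  move=> Dw hw; rewrite ltNge; apply/negP => pw.
  apply: (@no_strict_extremum z p w (h p / 2)) => //; first by rewrite (ltW zp).
  by left; rewrite hz hw; split; [apply/andP; split|]; lra.
(* If [h x] were positive, the zero [w] would be a strict minimum between [x] and [p]. *)
have zero_down w x : D w -> h w = 0 -> D x -> x <= w -> h x = 0.
  move=> Dw hw Dx xw; apply/eqP; apply: contraT => hx0.
  have hx : 0 < h x by rewrite lt_def hx0 h_ge0.
  case: (@no_strict_extremum x w p (Num.min (h x) (h p))) => //.
  - by rewrite xw ltW // zero_lt.
  - by rewrite lt_min hx.
  by right; rewrite hw lt_min hx hp !ge_min !lexx orbT.
pose Z := [set x | D x /\ h x = 0].
have Zz : Z z by [].
have supZ : has_sup Z.
  by split; [exists z|exists p => w [Dw hw]; apply/ltW/zero_lt].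
have zy : z <= sup Z by apply: ub_le_sup => //; case: supZ.
have yp : sup Z <= p.
  by apply: ge_sup; [exists z|move=> w [Dw hw]; apply/ltW/zero_lt].
have Dy : D (sup Z) by apply: D_itv Dz Dp _ _; rewrite zy.
have hy : h (sup Z) = 0.
  apply/eqP; apply: contraT => hy0.
  have {hy0} hy : 0 < h (sup Z) by rewrite lt_def hy0 h_ge0.
  (* Half of a positive value at the supremum would be attained at some [u] strictly below it; a
     zero above [u] then forces [h u = 0] by [zero_down]. *)
  have [|u /andP[zu uy] hu] := h_ivt (l := h (sup Z) / 2) Dz Dy zy.
    by rewrite hz ge_min le_max; apply/andP; split; apply/orP; [left|right]; lra.
  have Du : D u by apply: D_itv Dz Dy _ _; rewrite zu.
  have uy' : u < sup Z.
    by rewrite lt_neqAle uy andbT; apply/eqP => E; move: hu; rewrite E; lra.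
  have [w [Dw hw] uw] := sup_gt (ex_intro _ z Zz) uy'.
  by move: hu; rewrite (zero_down w) //; [lra|exact: ltW].
exists (sup Z); split=> // [x Dx xy|s t Ds Dt ys st]; first exact: zero_down xy.
have ht : 0 < h t.
  rewrite lt_def h_ge0 // andbT; apply/eqP => ht.
  have := lt_trans ys st; rewrite ltNge => /negP; apply.
  by apply: ub_le_sup => //; case: supZ.
(* Equality contradicts injectivity at positive values; a decrease makes [s] a strict maximum
   between [sup Z] and [t], tested at the midpoint level. *)
rewrite ltNge le_eqVlt; apply/negP => /orP[/eqP E|hts].
  by move: st; rewrite (h_inj Dt Ds ht E) ltxx.
apply: (@no_strict_extremum (sup Z) s t ((h s + h t) / 2)) => //.
- by rewrite !ltW.
- by rewrite divr_gt0 // addr_gt0 // (lt_trans ht).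
by left; rewrite hy; split; [apply/andP; split|]; lra.
Qed.

End Unimodal.

Lemma hirsch_spec (R : realType) (f : R -> R) (theta : R) :
  hirsch_defined f -> 0 < theta -> hirsch_solutions f theta (hirsch f theta).
Proof. by move=> fd /fd[x [fx _]]; exact: xgetI fx. Qed.

Lemma hirsch_pos_inj (R : realType) (f : R -> R) (s t : R) :
  hirsch_defined f -> 0 < s -> 0 < t ->
  0 < hirsch f s -> hirsch f s = hirsch f t -> s = t.
Proof.
move=> fd s0 t0 hs E.
have [_ fs _] := hirsch_spec fd s0; have [_ ft _] := hirsch_spec fd t0.
by apply: (mulIf (lt0r_neq0 hs)); rewrite -fs E ft.
Qed.

Theorem mainTheorem6 (R : realType) (f : R -> R)
    (f_nonneg : maps_nonneg_to_nonneg f)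
    (f_hirsch : hirsch_defined f)
    (h_cont : {within [set` `]0, +oo[%R], continuous (hirsch f)}) :
  [\/ {in `]0, +oo[%R &, injective (hirsch f)},
      exists y0 : R, [/\ 0 < y0,
        {in `]0, y0]%R, forall theta, hirsch f theta = 0} &
        {in `]y0, +oo[%R &, {homo hirsch f : s t / s < t}}]
    | (exists x0 : R, [/\ 0 < x0,
        {in `[x0, +oo[%R, forall theta, hirsch f theta = 0} &
        {in `]0, x0[%R &, {homo hirsch f : s t /~ s < t}}])
      \/ {in `]0, +oo[%R, forall theta, hirsch f theta = 0}].
Proof.
pose h := hirsch f.
have h_ge0 x : 0 < x -> 0 <= h x by move=> /(hirsch_spec f_hirsch)[].
have h_inj x y : 0 < x -> 0 < y -> 0 < h x -> h x = h y -> x = y.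
  exact: hirsch_pos_inj.
have h_ivt a b l : 0 < a -> 0 < b -> a <= b ->
    Num.min (h a) (h b) <= l <= Num.max (h a) (h b) ->
    exists2 c, a <= c <= b & h c = l.
  move=> a0 _ ab /(IVT ab)[|c]; last by rewrite in_itv; exists c.
  apply: continuous_subspaceW h_cont => x; rewrite /= !in_itv /= andbT.
  by move=> /andP[ax _]; exact: lt_le_trans ax.
have [[z [z0 hz]]|nz] := pselect (exists z, 0 < z /\ h z = 0); last first.
  apply: Or31 => x y; rewrite !in_itv /= !andbT => x0 y0.
  apply: h_inj => //; rewrite lt_def h_ge0 // andbT.
  by apply/eqP => hx; apply: nz; exists x.
have [[p [p0 hp]]|np] := pselect (exists p, 0 < p /\ 0 < h p); last first.
  apply: Or33; right => x; rewrite in_itv /= andbT => x0.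
  apply/eqP; apply: contraT => hx; case: np; exists x; split=> //.
  by rewrite lt_def hx h_ge0.
(* The relative position of a zero [z] and a positive point [p] decides between types (ii) and
   (iii). *)
have [zp|pz|E] := ltgtP z p; last by move: hp; rewrite -E hz ltxx.
  have D_itv : is_interval [set x : R | 0 < x].
    by move=> a b /= a0 _ x /andP[ax _]; exact: lt_le_trans ax.
  have [y0 [y00 hy0 hy]] :=
    zero_then_increasing D_itv h_ge0 h_inj h_ivt z0 p0 zp hz hp.
  apply: Or32; exists y0; split=> // [x|s t].
    by rewrite in_itv /= => /andP[x0 xy]; exact: hy0.
  rewrite !in_itv /= !andbT => ys yt.
  by apply: hy => //=; exact: lt_trans y00 _.
(* Now [p < z], so after reflection the zero [- z] lies left of [- p]. The resulting [y0] is
   negative, and [- y0] serves as [x0]. *)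
have [|||||||||y0 [y00 hy0 hy]] := @zero_then_increasing R [set x | x < 0]
    (h \o -%R) _ _ _ _ (- z) (- p).
- by move=> a b /= _ b0 x /andP[_ xb]; exact: le_lt_trans xb b0.
- by move=> x /= x0; rewrite h_ge0 // oppr_gt0.
- move=> x y /= x0 y0 hx E; apply: oppr_inj.
  by apply: h_inj => //; rewrite oppr_gt0.
- move=> a b l /= a0 b0 ab; rewrite minC maxC => H.
  have [|||c /andP[bc ca] hc] := h_ivt (- b) (- a) l _ _ _ H.
  + by rewrite oppr_gt0.
  + by rewrite oppr_gt0.
  + by rewrite lerN2.
  by exists (- c); rewrite ?opprK // lerNr lerNl bc ca.
- by rewrite /= oppr_lt0.
- by rewrite /= oppr_lt0.
- by rewrite ltrN2.
- by rewrite /= opprK.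
- by rewrite /= opprK.
apply: Or33; left; exists (- y0); split=> [|x|s t].
- by rewrite oppr_gt0.
- rewrite in_itv /= andbT => yx; rewrite -(opprK x); apply: hy0.
    by rewrite /= oppr_lt0 (lt_le_trans _ yx) // oppr_gt0.
  by rewrite lerNl.
rewrite !in_itv /= => /andP[s0 sy] /andP[t0 ty] ts.
rewrite -[s]opprK -[t]opprK; apply: hy.
- by rewrite /= oppr_lt0.
- by rewrite /= oppr_lt0.
- by rewrite ltrNr.
by rewrite ltrN2.
Qed.
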